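(* (Dedekind's Theorem.) For all $\gamma\in\omega^\omega$: if $\forall n[q_{\gamma(n)}\le q_{\gamma(n+1)}]$ and $\forall\zeta\in[\omega]^\omega\,\exists n\big[q_{\gamma(\zeta(n))}+\frac{1}{2^n}<q_{\gamma(\zeta(n+1))}\big]$, then $\exists n[1<q_{\gamma(n)}]$.
   Context: Setting: intuitionistic mathematics (intuitionistic logic), assuming the axioms of countable choice and Brouwer's Bar Theorem in the form of Bar Induction: if $B,C\subseteq\omega$, $B$ is a bar in $\omega^\omega$ (i.e. $\forall\alpha\exists n[\langle\alpha(0),\dots,\alpha(n-1)\rangle\in B]$, finite sequences coded by numbers), $B\subseteq C$ and $\forall s[s\in C\leftrightarrow\forall n[s\ast\langle n\rangle\in C]]$, then $\langle\,\rangle\in C$. $q_0,q_1,\dots$ is a fixed enumeration of the rationals $\mathbb{Q}$. $[\omega]^\omega=\{\zeta\in\omega^\omega\mid\forall n[\zeta(n)<\zeta(n+1)]\}$. *)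

(* Defs.v *)
From mathcomp Require Import all_boot all_order all_algebra.
From Stdlib Require ChoiceFacts.
Set Implicit Arguments.
Unset Strict Implicit.
Unset Printing Implicit Defensive.

(* Rocq's logic is intuitionistic, so the two non-logical principles are
   propositions to be assumed, never axioms of the development.  *)

(* Countable choice for numbers (AC_{0,0}) and for infinite sequences of
   numbers (AC_{0,1}). *)
Definition countable_choice : Prop :=
  ChoiceFacts.FunctionalCountableChoice_on nat /\
  ChoiceFacts.FunctionalCountableChoice_on (nat -> nat).

(* Finite sequences are taken as lists instead of through numerical codes:
   s * <n> is [rcons s n] and <a(0), ..., a(n-1)> is [mkseq a n]. *)
Definition is_bar (B : seq nat -> Prop) : Prop :=
  forall a : nat -> nat, exists n : nat, B (mkseq a n).

Definition bar_induction : Prop :=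
  forall B C : seq nat -> Prop,
    is_bar B ->
    (forall s, B s -> C s) ->
    (forall s, C s <-> forall n, C (rcons s n)) ->
    C [::].

(* Repetitions are allowed. *)
Definition enumeration (T : Type) (q : nat -> T) : Prop :=
  forall x, exists n, q n = x.

(* The set [omega]^omega. *)
Definition strictly_increasing (z : nat -> nat) : Prop :=
  forall n, z n < z n.+1.

(* Main.v *)
(** Code a strictly increasing [z] by its gaps, so that every finite sequence of
    numbers codes an initial part of some [z].  The bar consists of the codes in
    which some jump [x (z n) + 2^-n < x (z n.+1)] has already occurred.  Monotone
    bar induction is applied to "a jump has occurred, or [x] climbs by more than
    [2^-n] above its last value [x (z n)]".  To see that this is inductive,
    choose first [z n + 1] as the next entry: either a jump occurs, or some
    [x M] lies more than [2^-n.+1] above [x (z n)].  Then choose [M] instead as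
    the next entry: either a jump occurs, or [x] climbs by [2^-n.+1] once more.
    At the root, [x] climbs by more than [1] above each of its values. *)
Require Import Defs.
From mathcomp Require Import all_boot all_order all_algebra.
Import Order.TTheory GRing.Theory Num.Theory.
Local Open Scope ring_scope.

Lemma monotone_bar_induction (hBI : bar_induction) (B C : seq nat -> Prop) :
  is_bar B -> (forall s n, B s -> B (rcons s n)) ->
  (forall s, B s -> C s) ->
  (forall s, (forall n, C (rcons s n)) -> C s) ->
  C [::].
Proof.
move=> barB monB BC indC.
(* The hereditary part of [C] satisfies both directions of the equivalence. *)
apply: (hBI B (fun s => forall t, C (s ++ t)) barB _ _ [::]) => [s Bs t|s].
  apply: BC; elim/last_ind: t => [|t n IHt]; first by rewrite cats0.
  by rewrite -rcons_cat; apply: monB.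
split=> [Cs n t|Cs [|n t]]; first by rewrite cat_rcons.
  by rewrite cats0; apply: indC => n; rewrite -(cats0 (rcons s n)).
by rewrite -cat_rcons.
Qed.

(* The last of the strictly increasing numbers [s0], [s0 + s1 + 1],
   [s0 + s1 + s2 + 2], ... coded by [s]; it is [0] for the empty code. *)
Definition coded_last (s : seq nat) : nat := (sumn s + (size s).-1)%N.

Definition has_jump (x : nat -> rat) (s : seq nat) : bool :=
  has (fun n => x (coded_last (take n.+1 s)) + 2 ^- n
                < x (coded_last (take n.+2 s)))
      (iota 0 (size s).-1).

Lemma coded_last_rcons s a b :
  coded_last (rcons (rcons s a) b) = (coded_last (rcons s a) + b).+1.
Proof.
by rewrite /coded_last !sumn_rcons !size_rcons /= addnAC !addnS.
Qed.

Lemma has_jump_rcons x s a b :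
  has_jump x (rcons (rcons s a) b) =
  has_jump x (rcons s a) ||
  (x (coded_last (rcons s a)) + 2 ^- size s
   < x (coded_last (rcons (rcons s a) b))).
Proof.
rewrite /has_jump !size_rcons [_.-1](esym (addn1 _))
  iotaD has_cat has_seq1 add0n.
congr (_ || _).
  apply: eq_in_has => n; rewrite mem_iota add0n => /= lt_n_s.
  by rewrite -(cats1 _ b) !takel_cat // size_rcons // ltnW.
rewrite -(cats1 _ b) takel_cat ?size_rcons // !take_oversize //.
  by rewrite size_cat size_rcons addn1.
by rewrite size_rcons.
Qed.

Lemma has_jump_monotone x s n : has_jump x s -> has_jump x (rcons s n).
Proof.
by case/lastP: s => // s a; rewrite has_jump_rcons => ->.
Qed.

Lemma has_jump_bar (x : nat -> rat) :
  (forall z, strictly_increasing z ->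
     exists n, x (z n) + 2 ^- n < x (z n.+1)) ->
  is_bar (has_jump x).
Proof.
move=> hsub a.
have [|n jump_n] := hsub (fun n => coded_last (mkseq a n.+1)).
  by move=> n; rewrite !mkseqS coded_last_rcons ltnS leq_addr.
(* Jump [n] involves entries [n] and [n.+1]. *)
exists n.+2; rewrite !mkseqS has_jump_rcons size_mkseq.
by apply/orP; right; rewrite -!mkseqS.
Qed.

Lemma unbounded_of_unit_climbs (x : nat -> rat) (c : rat) :
  (forall m, exists M, x m + 1 < x M) -> exists n, c < x n.
Proof.
move=> climb.
have climbs k : exists n, x 0 + k%:R <= x n.
  elim: k => [|k [n le_n]]; first by exists 0; rewrite addr0.
  have [M lt_M] := climb n; exists M.
  by rewrite mulrSr addrA (le_trans _ (ltW lt_M)) // lerD2r.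
have [n le_n] := climbs (Num.bound `|c - x 0|).
exists n; apply: lt_le_trans le_n.
by rewrite -ltrBlDl (le_lt_trans (ler_norm _)) // archi_boundP.
Qed.

Lemma unbounded_of_jumps (hBI : bar_induction) (x : nat -> rat) (c : rat) :
  (forall n, x n <= x n.+1) ->
  (forall z, strictly_increasing z ->
     exists n, x (z n) + 2 ^- n < x (z n.+1)) ->
  exists n, c < x n.
Proof.
move=> hmono hsub.
have mono : {homo x : m n / (m <= n)%N >-> m <= n}.
  by apply: homo_leq => //; exact: le_trans.
(* The empty code has no genuine last value, so the root carries the goal itself. *)
pose C s := if s is [::] then exists n, c < x n
  else has_jump x s \/ exists M, x (coded_last s) + 2 ^- (size s).-1 < x M.
apply: (@monotone_bar_induction hBI (has_jump x) C).
- exact: has_jump_bar.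
- exact: has_jump_monotone.
- by case=> // a s; left.
case/lastP=> [Cn|s a Cs].
  apply: unbounded_of_unit_climbs => m.
  (* A one-entry code has no jump, and its climb is [2 ^- 0], that is 1. *)
  by case: (Cn m) => // -[M]; rewrite /coded_last /= !addn0 invr1; exists M.
have Crcons t d : C (rcons t d) = (has_jump x (rcons t d) \/
    exists M, x (coded_last (rcons t d)) + 2 ^- size t < x M).
  by rewrite -[size t]/(size t).+1.-1 -(size_rcons t d); case: t.
rewrite Crcons; set m := coded_last (rcons s a).
(* The gap [M - m.+1] makes [M] the next entry; a jump is then old or ends at [M]. *)
have {}Cs M : (m < M)%N -> [\/ has_jump x (rcons s a),
    x m + 2 ^- size s < x M | exists N, x M + 2 ^- (size s).+1 < x N].
  move=> lt_mM; have := Cs (M - m.+1)%N.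
  rewrite Crcons has_jump_rcons coded_last_rcons -/m -addSn subnKC // size_rcons.
  by case=> [/orP[]|]; [apply: Or31|apply: Or32|apply: Or33].
have half : 2 ^- size s = 2 ^- (size s).+1 + 2 ^- (size s).+1 :> rat.
  by rewrite exprSr invfM -splitr.
have [jump_s|lt_m|[M lt_M]] := Cs m.+1 (ltnSn m);
  [by left|by right; exists m.+1|].
(* [M] need not exceed [m]; by monotonicity a larger index, legal as next entry, serves as well. *)
have {}lt_M : x m + 2 ^- (size s).+1 < x (maxn M m.+1).
  apply: le_lt_trans (lt_le_trans lt_M (mono _ _ (leq_maxl _ _))).
  by rewrite lerD2r.
have [jump_s|lt_m|[N lt_N]] := Cs _ (leq_maxr M m.+1);
  [by left|by right; exists (maxn M m.+1)|].
right; exists N; apply: lt_trans lt_N.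
by rewrite half addrA ltrD2r.
Qed.

Theorem theorem7p12
  (hCC : countable_choice) (hBI : bar_induction)
  (q : nat -> rat) (hq : enumeration q)
  (gamma : nat -> nat)
  (hmono : forall n, q (gamma n) <= q (gamma n.+1))
  (hsub : forall zeta : nat -> nat, strictly_increasing zeta ->
     exists n, q (gamma (zeta n)) + 1 / 2 ^+ n < q (gamma (zeta n.+1))) :
  exists n, 1 < q (gamma n).
Proof.
apply: (@unbounded_of_jumps hBI (q \o gamma)) => // z /hsub[n].
by rewrite div1r; exists n.
Qed.
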